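(* For each $1\leq p <\infty$, the following decomposition into complemented subspaces holds: $L^{p}(\mu)=G^{p}\oplus B^{p}\cong \ell^{p}(\mathfrak c,L^{p}[0,1])\oplus B^{p}$.
   Context: Let $\mathcal{B}$ be the Borel $\sigma$-algebra of $\mathbb{R}$, $\lambda$ the Lebesgue measure, and $\mathcal{B}_{\infty}$ the $\sigma$-algebra on $\mathbb{R}^{\mathbb{N}}$ generated by the cylinder sets $\prod_{i=1}^{m}C_{i}\times\prod_{i=m+1}^{\infty}\mathbb{R}$ with $C_i\in\mathcal{B}$, $m\in\mathbb{N}$. Let $\mathcal{F}(\mathcal{B},\lambda)$ be the set of finite rectangles $\prod_{i\in\mathbb{N}}C_{i}$ with $C_i\in\mathcal{B}$ and $\prod_{i}\lambda(C_i)\in[0,\infty)$, with $\mathrm{vol}(\prod_{i}C_i):=\prod_i\lambda(C_i)$. The measure $\mu$ is the restriction to $\mathcal{B}_{\infty}$ of the outer measure $\mu^{\ast}(A):=\inf\{\sum_{n}\mathrm{vol}(\mathscr{C}_{n}) : \mathscr{C}_{n}\in\mathcal{F}(\mathcal{B},\lambda),\ A\subset\bigcup_{n}\mathscr{C}_{n}\}$ ($\inf\varnothing=\infty$). Let $I:=\mathbb{Z}^{\mathbb{N}}$ and, for $\mathfrak{a}=(a_n)\in I$, $\mathcal{C}_{\mathfrak{a}}:=\prod_{n\in\mathbb{N}}[a_{n},a_{n}+1)$. For $f\in L^p(\mu)$ let $\mathcal{O}_{f}:=\{\mathfrak{a}\in I : \int_{\mathcal{C}_{\mathfrak{a}}}|f|^{p}\,d\mu\neq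 0\}$ and $\mathcal{F}_{f}:=\bigsqcup_{\mathfrak{a}\in\mathcal{O}_{f}}\mathcal{C}_{\mathfrak{a}}$. Define $G^{p}:=\{f\in L^{p}(\mu) : \int_{\mathbb{R}^{\mathbb{N}}}|f|^{p}\,d\mu=\sum_{\mathfrak{a}\in\mathcal{O}_{f}}\int_{\mathcal{C}_{\mathfrak{a}}}|f|^{p}\,d\mu=\int_{\mathcal{F}_{f}}|f|^{p}\,d\mu\}$ and $B^{p}:=\{f\in L^{p}(\mu) : \int_{\mathcal{C}_{\mathfrak{a}}}|f|^{p}\,d\mu=0 \text{ for each } \mathfrak{a}\in I\}$, both closed subspaces of $L^p(\mu)$. $\ell^{p}(\kappa,X)$ denotes the $\ell^p$-sum of $\kappa$ copies of the Banach space $X$, and $\mathfrak{c}$ is the cardinality of the continuum. *)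

(* Defs.v *)
From HB Require Import structures.
From mathcomp Require Import all_boot all_order all_algebra.
From mathcomp Require Import all_classical all_reals all_analysis.
Import Order.TTheory GRing.Theory Num.Theory.

Set Implicit Arguments.
Unset Strict Implicit.
Unset Printing Implicit Defensive.

Local Open Scope classical_set_scope.
Local Open Scope ring_scope.

(* The carrier R^N (sequences indexed by nat; index 0 plays the role of 1). *)
Definition RN (R : realType) := nat -> R.
HB.instance Definition _ (R : realType) := Choice.on (RN R).
HB.instance Definition _ (R : realType) := isPointed.Build (RN R) (fun _ => 0).

Section Defs.
Context {R : realType}.

Definition cylinders : set (set (RN R)) :=
  [set A | exists (m : nat) (C : nat -> set R),
     (forall i, measurable (C i)) /\
     A = [set x : RN R | forall i, (i < m)%N -> C i (x i)]].

Definition Binf := g_sigma_algebraType cylinders.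

Local Open Scope ereal_scope.

Definition rect (C : nat -> set R) : set (RN R) := [set x | forall i, C i (x i)].

Definition rect_pprod (C : nat -> set R) (n : nat) : \bar R :=
  \big[*%E/1%E]_(i < n) lebesgue_measure (C i).

Definition vol (C : nat -> set R) : \bar R := limn (rect_pprod C).

Definition finite_rect (C : nat -> set R) : Prop :=
  (forall i, measurable (C i)) /\ cvgn (rect_pprod C) /\ vol C \is a fin_num.

(* The outer measure mu^*  (ereal_inf set0 = +oo). *)
Definition mu_star (A : set (RN R)) : \bar R :=
  ereal_inf [set s | exists Cs : nat -> nat -> set R,
    (forall n, finite_rect (Cs n)) /\
    A `<=` \bigcup_n rect (Cs n) /\
    s = \sum_(0 <= n <oo) vol (Cs n)].

Definition cube (a : nat -> int) : set Binf :=
  [set x | forall n, ((a n)%:~R <= x n)%R /\ (x n < (a n + 1)%:~R)%R].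

Variable mu : {measure set Binf -> \bar R}.
Variable p : R.

Definition Lpnorm (f : Binf -> R) : \bar R := 'N[mu]_p%:E [EFin \o f].

Definition cube_int (f : Binf -> R) (a : nat -> int) : \bar R :=
  \int[mu]_(x in cube a) (`|f x| `^ p)%:E.

Definition Oset (f : Binf -> R) : set (nat -> int) :=
  [set a | cube_int f a != 0].
Definition Fset (f : Binf -> R) : set Binf := \bigcup_(a in Oset f) cube a.

Definition inG (f : Binf -> R) : Prop :=
  f \in Lfun mu p%:E /\
  \int[mu]_x (`|f x| `^ p)%:E = \esum_(a in Oset f) cube_int f a /\
  \esum_(a in Oset f) cube_int f a = \int[mu]_(x in Fset f) (`|f x| `^ p)%:E.

Definition inB (f : Binf -> R) : Prop :=
  f \in Lfun mu p%:E /\ forall a, cube_int f a = 0.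

End Defs.

Section Lp01.
Context {R : realType}.
Local Open Scope ereal_scope.

(* Lebesgue measure restricted to [0,1]; L^p[0,1] = L^p of this measure. *)
Definition lam01 := mrestr (@lebesgue_measure R) (measurable_itv `[0%R, 1%R]).

Variable p : R.

(* l^p(c, L^p[0,1]) with index set R (which has cardinality c):
   families (F k)_{k in R} of elements of L^p[0,1] with sum_k ||F k||^p < oo. *)
Definition lp_norm (F : R -> R -> R) : \bar R :=
  (\esum_(k in [set: R]) ('N[lam01]_p%:E [EFin \o F k]) `^ p) `^ p^-1.

Definition in_lp (F : R -> R -> R) : Prop :=
  (forall k, F k \in Lfun lam01 p%:E) /\
  \esum_(k in [set: R]) ('N[lam01]_p%:E [EFin \o F k]) `^ p < +oo.

End Lp01.

(* Main.v *)
Require Import Defs.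
From HB Require Import structures.
From mathcomp Require Import finmap.
From mathcomp Require Import all_boot all_order all_algebra.
From mathcomp Require Import all_classical all_reals all_analysis.
From mathcomp Require Import ring lra measurable_realfun.
Import Order.TTheory GRing.Theory Num.Theory.
Import numFieldNormedType.Exports.

(* On a cube the measure [mu] is a copy of Lebesgue measure on [0,1].  Splitting
   the binary digits of a uniform [x] into even and odd positions gives two
   independent uniform numbers (baker's map); iterating on the odd part yields an
   i.i.d. uniform sequence [(u_n)] that determines [x] almost everywhere.  Let
   [nu] be the law of [(a_n + u_n)].  A finite rectangle has [nu]-mass at most its
   volume, so [nu <= mu_star] by subadditivity, while [mu_star (cube a) <= 1];
   complementing in the cube, [mu] and [nu] agree there.  Hence composing [f] with
   these parametrisations of the cubes, which are indexed by Z^N and so by the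
   continuum, maps G^p isometrically onto l^p(c, L^p[0,1]).  The projection onto
   G^p along B^p is [f |-> f \1_(F_f)], where [O_f] is countable because the
   cubes are disjoint and [|f|^p] is integrable. *)

Set Implicit Arguments.
Unset Strict Implicit.
Unset Printing Implicit Defensive.
Local Open Scope classical_set_scope.
Local Open Scope ring_scope.

(** * Binary digits *)

Section BinaryDigits.
Context {R : realType}.
Implicit Types (b : nat -> R) (x : R).

(** Real digits between 0 and 1 already give convergence and the bounds; this weak form fits the
    measurable digit functions of [digit_of_ucoords], which are binary only where that is needed. *)
Definition digits01 b := forall n, 0 <= b n <= 1.

Definition bin_series b : R^nat := series (fun j => b j / 2 ^+ j.+1).

Definition bin_val b : R := limn (bin_series b).

Lemma half_expn_sum n : \sum_(0 <= i < n) (2 ^+ i.+1)^-1 = 1 - (2 ^+ n)^-1 :> R.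
Proof.
elim: n => [|n IH]; first by rewrite big_geq// expr0 invr1 subrr.
rewrite big_nat_recr//= IH exprS invfM.
have : 2 ^+ n != 0 :> R by rewrite expf_neq0.
by move=> ?; field.
Qed.

Lemma bin_series_ge0 b n : digits01 b -> 0 <= bin_series b n.
Proof.
move=> b01; rewrite /bin_series /series/=; apply: sumr_ge0 => i _.
by rewrite divr_ge0 ?exprn_ge0//; case/andP: (b01 i).
Qed.

Lemma bin_series_le1 b n : digits01 b -> bin_series b n <= 1.
Proof.
move=> b01; rewrite /bin_series /series/=.
apply: (@le_trans _ _ (\sum_(0 <= i < n) (2 ^+ i.+1)^-1)).
  apply: ler_sum => i _; rewrite ler_piMl ?invr_ge0 ?exprn_ge0//.
  by case/andP: (b01 i).
by rewrite half_expn_sum gerBl invr_ge0 exprn_ge0.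
Qed.

Lemma is_cvg_bin_series b : digits01 b -> cvgn (bin_series b).
Proof.
move=> b01; apply: nondecreasing_is_cvgn.
  apply/nondecreasing_seqP => n; rewrite /bin_series /series/= big_nat_recr//=.
  by rewrite lerDl divr_ge0 ?exprn_ge0//; case/andP: (b01 n).
by exists 1 => _ [n _ <-]; exact: bin_series_le1.
Qed.

Lemma bin_val_ge0 b : digits01 b -> 0 <= bin_val b.
Proof.
move=> b01; apply: limr_ge; first exact: is_cvg_bin_series.
by apply: nearW => n; exact: bin_series_ge0.
Qed.

Lemma bin_val_le1 b : digits01 b -> bin_val b <= 1.
Proof.
move=> b01; apply: limr_le; first exact: is_cvg_bin_series.
by apply: nearW => n; exact: bin_series_le1.
Qed.

Lemma bin_val_rec b : digits01 b ->
  bin_val b = (b 0%N + bin_val (fun n => b n.+1)) / 2.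
Proof.
move=> b01; apply/cvg_lim => //; rewrite -cvg_shiftS /=.
have -> : (fun n => bin_series b n.+1) =
    (fun n => (b 0%N + bin_series (fun n => b n.+1) n) / 2).
  apply/funext => n; rewrite /bin_series /series/= big_nat_recl//=.
  rewrite mulrDl expr1 mulr_suml; congr (_ + _).
  by apply: eq_bigr => i _; rewrite exprSr invfM; ring.
apply: cvgMl; apply: cvgD; first exact: cvg_cst.
by apply: is_cvg_bin_series => n.
Qed.

(** * The doubling map on [0,1) and the binary digits it produces *)

Definition half_shift x : R := if x < 2^-1 then 2 * x else 2 * x - 1.

Definition half_digit x : R := if x < 2^-1 then 0 else 1.

Definition digit (n : nat) x : R := half_digit (iter n half_shift x).

Lemma digit01 x (f : nat -> nat) : digits01 (fun n => digit (f n) x).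
Proof. by move=> n; rewrite /digit /half_digit; case: ifP => _; rewrite lexx ler01. Qed.

Lemma half_shift_itv x : 0 <= x < 1 -> 0 <= half_shift x < 1.
Proof. by rewrite /half_shift; case: ifPn; rewrite -?leNgt => ? ?; lra. Qed.

Lemma iter_half_shift_itv n x : 0 <= x < 1 -> 0 <= iter n half_shift x < 1.
Proof. by move=> x01; elim: n => //= n; exact: half_shift_itv. Qed.

Lemma half_shiftE x : x = (half_digit x + half_shift x) / 2.
Proof. by rewrite /half_digit /half_shift; case: ifP => _; lra. Qed.

Lemma bin_val_digit x : 0 <= x < 1 -> bin_val (digit ^~ x) = x.
Proof.
move=> x01.
(* The remainder after [n] digits is exactly the [n]-th iterate of the doubling map, scaled by 2^-n;
   the iterate stays in [0,1), so the remainder tends to 0. *)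
have E n : x = bin_series (digit ^~ x) n + (2 ^+ n)^-1 * iter n half_shift x.
  elim: n => [|n IH]; first by rewrite /bin_series /series/= big_geq// expr0; lra.
  rewrite {1}IH /bin_series /series/= big_nat_recr//= -addrA; congr (_ + _).
  rewrite {1}(half_shiftE (iter n _ x)) -/(digit n x) exprS invfM.
  have : 2 ^+ n != 0 :> R by rewrite expf_neq0.
  by move=> ?; field.
apply/cvg_lim => //.
have -> : bin_series (digit ^~ x) = (fun n => x - 2^-1 ^+ n * iter n half_shift x).
  by apply/funext => n; rewrite {2}(E n) exprVn addrK.
rewrite -[X in _ --> X]subr0; apply: cvgB; first exact: cvg_cst.
apply: (@squeeze_cvgr _ _ _ _ (cst 0) (fun n => 2^-1 ^+ n)); last 2 first.
- exact: cvg_cst.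
- by apply: cvg_expr; rewrite ger0_norm ?invr_ge0//; lra.
apply: nearW => n; case/andP: (iter_half_shift_itv n x01) => h0 h1.
have e0 : 0 <= 2^-1 ^+ n :> R by rewrite exprn_ge0// invr_ge0.
by rewrite mulr_ge0//= ler_piMr// ltW.
Qed.

(** * Splitting the binary digits by parity of position *)

Definition even_part x : R := bin_val (fun n => digit n.*2 x).

(** The digits in odd positions are the even-position digits after one shift. *)
Definition odd_part x : R := even_part (half_shift x).

Lemma even_part_ge0 x : 0 <= even_part x.
Proof. exact/bin_val_ge0/digit01. Qed.

Lemma even_part_le1 x : even_part x <= 1.
Proof. exact/bin_val_le1/digit01. Qed.

Lemma digitS n x : digit n.+1 x = digit n (half_shift x).
Proof. by rewrite /digit iterSr. Qed.

(** Deleting the leading digit and the next one leaves the even positions even; the term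
    [odd_part (half_shift x)] is the even part after two shifts. *)
Lemma even_part_rec x :
  even_part x = (half_digit x + odd_part (half_shift x)) / 2.
Proof.
rewrite /even_part bin_val_rec; last exact: digit01.
congr ((_ + _) / 2); rewrite /odd_part /even_part.
by congr bin_val; apply/funext => n; rewrite doubleS !digitS.
Qed.

Lemma half_digit_l x : x < 1 -> half_digit (x / 2) = 0.
Proof. by move=> x1; rewrite /half_digit ifT//; lra. Qed.

Lemma half_digit_r x : 0 <= x -> half_digit ((1 + x) / 2) = 1.
Proof. by move=> x0; rewrite /half_digit ifF//; apply/negbTE; rewrite -leNgt; lra. Qed.

Lemma half_shift_l x : x < 1 -> half_shift (x / 2) = x.
Proof. by move=> x1; rewrite /half_shift ifT; lra. Qed.

Lemma half_shift_r x : 0 <= x -> half_shift ((1 + x) / 2) = x.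
Proof.
by move=> x0; rewrite /half_shift ifF; [lra|apply/negbTE; rewrite -leNgt; lra].
Qed.

Lemma even_part_l x : x < 1 -> even_part (x / 2) = odd_part x / 2.
Proof. by move=> x1; rewrite even_part_rec half_digit_l// half_shift_l// add0r. Qed.

Lemma even_part_r x : 0 <= x -> even_part ((1 + x) / 2) = (1 + odd_part x) / 2.
Proof. by move=> x0; rewrite even_part_rec half_digit_r// half_shift_r. Qed.

Lemma odd_part_l x : x < 1 -> odd_part (x / 2) = even_part x.
Proof. by move=> x1; rewrite /odd_part half_shift_l. Qed.

Lemma odd_part_r x : 0 <= x -> odd_part ((1 + x) / 2) = even_part x.
Proof. by move=> x0; rewrite /odd_part half_shift_r. Qed.

(* If the even digits of [x] are eventually all 1, then [even_part] is 1 at some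
   shift of [x]; otherwise [even_part x] has exactly these digits. *)
Definition generic x := 0 <= x < 1 /\ forall n, even_part (iter n half_shift x) < 1.

Lemma generic_shift x : generic x -> generic (half_shift x).
Proof.
move=> [x01 gx]; split; first exact: half_shift_itv.
by move=> n; rewrite -iterSr.
Qed.

(** Genericity keeps the tail of the even digits strictly below 1, so it cannot carry into the
    leading digit. *)
Lemma half_digit_even_part x : generic x -> half_digit (even_part x) = half_digit x.
Proof.
move=> gx; have /= h1 := gx.2 2%N.
have h0 := even_part_ge0 (half_shift (half_shift x)).
rewrite even_part_rec /odd_part [in RHS]/half_digit {2}/half_digit.
case: ifPn => _; first by rewrite add0r half_digit_l.
exact: half_digit_r.
Qed.

Lemma half_shift_even_part x : generic x ->
  half_shift (even_part x) = even_part (half_shift (half_shift x)).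
Proof.
move=> gx; have := half_shiftE (even_part x).
rewrite half_digit_even_part// {1}even_part_rec /odd_part; lra.
Qed.

Lemma digit_even_part n x : generic x -> digit n (even_part x) = digit n.*2 x.
Proof.
elim: n x => [|n IH] x gx; first exact: half_digit_even_part.
rewrite digitS half_shift_even_part// IH; last by do 2 apply: generic_shift.
by rewrite doubleS !digitS.
Qed.

Lemma digit_odd_part n x : generic x -> digit n (odd_part x) = digit n.*2.+1 x.
Proof. by move=> gx; rewrite digit_even_part ?digitS//; exact: generic_shift. Qed.

End BinaryDigits.

(** * Uniform measure and dyadic rays *)

(** Bundles the pushforward as a measure, with the measurability proof explicit, so that it can be
    handed to uniqueness and change-of-variables lemmas. *)
Definition image_measure d1 d2 (T1 : measurableType d1) (T2 : measurableType d2)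
    (R : realType) (m : {measure set T1 -> \bar R}) (f : T1 -> T2)
    (mf : measurable_fun setT f) : {measure set T2 -> \bar R}.
Proof. by refine (pushforward m f : {measure set T2 -> \bar R}). Defined.

Section Uniform.
Context {R : realType}.
Implicit Types (x q r : R).

Definition dyadic (n : nat) (q : R) := exists k : int, 2 ^+ n * q = k%:~R.

Lemma dyadicW n m q : (n <= m)%N -> dyadic n q -> dyadic m q.
Proof.
move=> /subnKC <- [k Ek]; exists (k * 2 ^+ (m - n)).
by rewrite exprD mulrAC Ek intrM rmorphXn.
Qed.

(** A generating family of the Borel sets, stable under intersection; dyadic endpoints allow tail
    functions to be compared by induction on the denominator. *)
Definition dyadic_rays : set (set R) :=
  [set A | exists n q, dyadic n q /\ A = `[q, +oo[%classic].

Definition dyadic_floor n x : R := (Num.floor (2 ^+ n * x))%:~R / 2 ^+ n.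

Lemma dyadic_dyadic_floor n x : dyadic n (dyadic_floor n x).
Proof.
exists (Num.floor (2 ^+ n * x)).
by rewrite mulrC divfK// gt_eqF// exprn_gt0.
Qed.

Lemma dyadic_floor_le n x : dyadic_floor n x <= x.
Proof.
rewrite /dyadic_floor ler_pdivrMr ?exprn_gt0// [x * _]mulrC.
by have /andP[h _] := floor_itv (2 ^+ n * x).
Qed.

Lemma dyadic_floor_gt x y : y < x -> exists n, y < dyadic_floor n x.
Proof.
move=> yx; have xy0 : 0 < x - y by rewrite subr_gt0.
have [n _ /(_ n (leqnn n))] : \forall n \near \oo, (2^-1 ^+ n : R) < x - y.
  have /cvgrPdist_lt /(_ _ xy0) : (2^-1 ^+ n : R) @[n --> \oo] --> 0.
    by apply: cvg_expr; rewrite ger0_norm ?invr_ge0//; lra.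
  by apply: filterS => n; rewrite sub0r normrN ger0_norm// exprn_ge0// invr_ge0.
rewrite exprVn => nxy.
have n0 : 0 < 2 ^+ n :> R by rewrite exprn_gt0.
exists n; rewrite /dyadic_floor.
have /andP[_] := floor_itv (2 ^+ n * x); rewrite intrD mulr1z ltr_pdivlMr//.
move: (Num.floor _)%:~R => k kx.
have : 2 ^+ n * (2 ^+ n)^-1 < 2 ^+ n * (x - y) by rewrite ltr_pM2l.
by rewrite mulfV ?gt_eqF//; move: (2 ^+ n) kx => e; lra.
Qed.

Lemma measurable_dyadic_rays :
  @measurable _ (measurableTypeR R) = <<s dyadic_rays >>.
Proof.
apply/seteqP; split; last first.
  apply: smallest_sub; first exact: sigma_algebra_measurable.
  by move=> _ [n [q [_ ->]]]; exact: measurable_itv.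
have -> : @measurable _ (measurableTypeR R) =
    (@RGenCInfty.G R).-sigma.-measurable.
  by rewrite -RGenCInfty.measurableE.
apply: smallest_sub; first exact: smallest_sigma_algebra.
move=> _ [x ->].
(* The dyadic floors approach [x] from below, so a closed ray is the intersection of countably many
   dyadic ones. *)
have -> : `[x, +oo[%classic = \bigcap_n `[dyadic_floor n x, +oo[%classic.
  apply/seteqP; split => y /=; rewrite ?in_itv/= ?andbT.
    move=> xy n _ /=; rewrite in_itv/= andbT.
    exact: le_trans (dyadic_floor_le _ _) xy.
  move=> h; rewrite leNgt; apply/negP => /dyadic_floor_gt[n].
  by have /= := h n Logic.I; rewrite in_itv/= andbT => /le_lt_trans/[apply]; rewrite ltxx.
apply: (@bigcap_measurableType _ (g_sigma_algebraType dyadic_rays)) => n _.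
by apply: sub_sigma_algebra; exists n, (dyadic_floor n x); split => //;
  exact: dyadic_dyadic_floor.
Qed.

Lemma ray_measure_unique (m1 m2 : {measure set (measurableTypeR R) -> \bar R}) :
  (m1 setT < +oo)%E ->
  (forall n q, dyadic n q -> m1 `[q, +oo[%classic = m2 `[q, +oo[%classic) ->
  forall A, measurable A -> m1 A = m2 A.
Proof.
move=> m1oo m12; apply: (@measure_unique _ R (measurableTypeR R) dyadic_rays
    (fun n => `[- n%:R, +oo[%classic) _ _ _ _ m1 m2).
- exact: measurable_dyadic_rays.
- move=> _ _ [n [q [qD ->]]] [m [r [rD ->]]].
  have [qr|rq] := leP q r.
    exists m, r; split => //; apply/seteqP; split => x /=; rewrite !in_itv/= !andbT.
      by case.
    by move=> rx; split => //; exact: le_trans rx.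
  exists n, q; split => //; apply/seteqP; split => x /=; rewrite !in_itv/= !andbT.
    by case.
  by move=> qx; split => //; exact: le_trans (ltW rq) qx.
- move=> i; exists 0%N, (- i%:R); split => //.
  by exists (- i%:Z); rewrite expr0 mul1r intrN.
- apply/seteqP; split => // x _.
  exists (Num.bound `|x|) => //=; rewrite in_itv/= andbT lerNl.
  by rewrite (le_trans (ler_norm _))// normrN ltW// archi_boundP.
- by move=> _ [n [q [qD ->]]]; exact: m12 qD.
- by move=> k; rewrite (le_lt_trans _ m1oo)// le_measure// inE.
Qed.

(** The half-open interval is the one that the doubling map sends into itself; [lam01_unif] passes
    to [0,1]. *)
Definition unif : {measure set (measurableTypeR R) -> \bar R} :=
  mrestr (@lebesgue_measure R) (measurable_itv `[0%R, 1%R[).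

Arguments unif : simpl never.

(** The tail function of the uniform law, see [unif_ray]. *)
Definition clamp q : R := Num.max 0 (Num.min 1 (1 - q)).

Lemma clamp_half q : clamp q = 2^-1 * (clamp (2 * q) + clamp (2 * q - 1)).
Proof.
rewrite /clamp /Num.min /Num.max.
by repeat case: ifPn; rewrite -?leNgt => *; lra.
Qed.
Lemma unif_ray q : unif `[q, +oo[%classic = (clamp q)%:E.
Proof.
rewrite /unif/= /mrestr /clamp.
have -> : (`[q, +oo[ `&` `[0, 1[ = `[Num.max q 0, 1[)%classic.
  apply/seteqP; split => x /=; rewrite !in_itv/= andbT ge_max.
    by case=> -> /andP[-> ->].
  by move=> /andP[/andP[-> ->] ->].
rewrite lebesgue_measure_itv/= lte_fin.
have [q0|q0] := leP q 0.
  by rewrite ltr01 sube0 min_l ?max_r//; lra.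
rewrite min_r; last by lra.
have [q1|q1] := ltP q 1; first by rewrite max_r ?EFinB//; lra.
by rewrite max_l//; lra.
Qed.

Lemma lam01_unif A : measurable A -> lam01 A = unif A.
Proof.
move=> mA; rewrite /lam01 /unif/= /mrestr.
have -> : (A `&` `[0, 1] = (A `&` `[0, 1[) `|` (A `&` [set 1]))%classic.
  by rewrite -setIUr setUitv1 // bnd_simp.
have mA1 : measurable (A `&` [set 1 : R]) by exact: measurableI.
have mA0 : measurable (A `&` `[(0:R), 1[%classic) by exact: measurableI.
have A10 : lebesgue_measure (A `&` [set 1 : R]) = 0%E.
  apply/eqP; rewrite eq_le measure_ge0 andbT -(lebesgue_measure_set1 (1 : R)).
  by apply: le_measure; rewrite ?inE//; exact: subIsetr.
apply/eqP; rewrite eq_le; apply/andP; split.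
  by rewrite (le_trans (measureU2 _ _ _))//= A10 adde0.
by rewrite le_measure// ?inE//; exact: measurableU.
Qed.


End Uniform.

(** * The baker's map *)

Section Baker.
Context {R : realType}.
Implicit Types (x q r : R) (C D E : set (measurableTypeR R)).
Local Notation unif := (@unif R).
Local Notation RR := (measurableTypeR R).

Lemma unif_eq E F : (forall x, 0 <= x < 1 -> E x <-> F x) -> unif E = unif F.
Proof.
move=> EF; rewrite /unif/= /mrestr; congr (lebesgue_measure _).
by apply/seteqP; split => x /= [Ex]; rewrite in_itv/= => x01; split => //; apply/EF.
Qed.

Lemma unifT : unif setT = 1%E.
Proof.
rewrite (@unif_eq _ `[0, +oo[%classic).
  by rewrite unif_ray /clamp subr0 min_l// max_r.
by move=> x /andP[x0 _]; rewrite /= in_itv/= x0.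
Qed.

Lemma unif_le1 E : measurable E -> (unif E <= 1)%E.
Proof. by move=> mE; rewrite -unifT le_measure// inE. Qed.

Lemma unif_fin_num E : measurable E -> unif E \is a fin_num.
Proof.
move=> mE; rewrite ge0_fin_numE//.
by rewrite (le_lt_trans (unif_le1 mE))// ltry.
Qed.

Lemma unif_setC0 E : measurable E -> unif E = 1%E -> unif (~` E) = 0%E.
Proof.
by move=> mE E1; rewrite -setTD measureD//= ?setTI ?E1 ?unifT ?subee// ltry.
Qed.

Lemma measurable_half_l : measurable_fun setT (fun x : RR => x / 2 : RR).
Proof. exact: measurable_funM. Qed.

Lemma measurable_half_r : measurable_fun setT (fun x : RR => (1 + x) / 2 : RR).
Proof. by apply: measurable_funM => //; exact: measurable_funD. Qed.

(** The uniform law is the average of its images under the two inverse branches of the doubling map;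
    on rays this is [clamp_half]. *)
Lemma unif_half E : measurable E ->
  unif E = (2^-1%:E * (unif [set x | E (x / 2)%R] + unif [set x | E ((1 + x) / 2)%R]))%E.
Proof.
have h0 : 0 <= 2^-1 :> R by rewrite invr_ge0.
pose m2 : {measure set RR -> \bar R} := mscale (NngNum h0) (measure_add
  (image_measure unif measurable_half_l) (image_measure unif measurable_half_r)).
have m2E E' : m2 E' = (2^-1%:E * (unif [set x | E' (x / 2)%R] +
    unif [set x | E' ((1 + x) / 2)%R]))%E.
  by rewrite /m2/= /mscale/= /msum !big_ord_recl big_ord0 adde0.
rewrite -m2E; move: E; apply: ray_measure_unique; first by rewrite unifT ltry.
move=> _ q _; rewrite m2E.
have -> : [set x : R | `[q, +oo[%classic (x / 2)] = `[2 * q, +oo[%classic.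
  by apply/seteqP; split => x /=; rewrite !in_itv/= !andbT => ?; lra.
have -> : [set x : R | `[q, +oo[%classic ((1 + x) / 2)] = `[2 * q - 1, +oo[%classic.
  by apply/seteqP; split => x /=; rewrite !in_itv/= !andbT => ?; lra.
by rewrite !unif_ray -EFinD -EFinM -clamp_half.
Qed.

Lemma unif_half_eq E0 E1 E : measurable E ->
  (forall x, 0 <= x < 1 -> E (x / 2) <-> E0 x) ->
  (forall x, 0 <= x < 1 -> E ((1 + x) / 2) <-> E1 x) ->
  unif E = (2^-1%:E * (unif E0 + unif E1))%E.
Proof.
by move=> mE EE0 EE1; rewrite unif_half//; congr (_ * (_ + _))%E; exact: unif_eq.
Qed.

Lemma measurable_half_digit : measurable_fun setT (@half_digit R : RR -> RR).
Proof.
by apply: measurable_fun_ifT => //; exact: measurable_fun_ltr.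
Qed.

Lemma measurable_half_shift : measurable_fun setT (@half_shift R : RR -> RR).
Proof.
have m2 : measurable_fun setT (fun x : RR => 2 * x : RR).
  by apply: (@measurable_funM _ _ _ _ (cst 2) id).
apply: measurable_fun_ifT.
- exact: measurable_fun_ltr.
- exact: m2.
- exact: measurable_funB.
Qed.

Lemma measurable_iter (f : RR -> RR) n :
  measurable_fun setT f -> measurable_fun setT (iter n f).
Proof.
move=> mf; elim: n => [|n IH]; first exact: measurable_id.
exact: (measurableT_comp mf IH).
Qed.

Lemma measurable_digit n : measurable_fun setT (digit n : RR -> RR).
Proof.
apply: (measurableT_comp measurable_half_digit).
exact: measurable_iter measurable_half_shift.
Qed.

Lemma measurable_bin_val d (T : measurableType d) (b : nat -> T -> R) :
  (forall n, measurable_fun setT (b n)) -> (forall x : T, digits01 (b ^~ x)) ->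
  measurable_fun setT (fun x : T => bin_val (b ^~ x)).
Proof.
move=> mb b01; apply: (@measurable_fun_cvg _ _ _ _
    (fun n (x : T) => bin_series (b ^~ x) n)).
  move=> n; rewrite /bin_series /series/=.
  by apply: measurable_sum => i; exact: measurable_funM.
by move=> x _; exact: is_cvg_bin_series.
Qed.

Lemma measurable_even_part : measurable_fun setT (@even_part R : RR -> RR).
Proof.
apply: (@measurable_bin_val _ RR (fun n x => digit n.*2 x)).
  by move=> n; exact: measurable_digit.
by move=> x; exact: digit01.
Qed.

Lemma measurable_odd_part : measurable_fun setT (@odd_part R : RR -> RR).
Proof. exact: (measurableT_comp measurable_even_part measurable_half_shift). Qed.

Lemma measurable_preimT (f : RR -> RR) E : measurable_fun setT f ->
  measurable E -> measurable (f @^-1` E).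
Proof. by move=> mf mE; rewrite -[_ @^-1` _]setTI; exact: mf. Qed.

(** Let u and v be the masses of the points whose even part, respectively odd part, reaches 1.
    Conditioning on the leading digit gives u = v/2, since that digit must be 1, and v = u; hence u
    = 0. *)
Lemma unif_even_part1 : unif [set x | 1 <= even_part x] = 0%E.
Proof.
set A1 := [set x | _].
have mray : measurable (`[1, +oo[%classic : set RR) by exact: measurable_itv.
have setE (f : RR -> RR) : [set x | 1 <= f x] = f @^-1` `[1, +oo[%classic.
  by apply/seteqP; split => x /=; rewrite in_itv/= andbT.
have mA1 : measurable (A1 : set RR).
  by rewrite /A1 setE; exact: measurable_preimT measurable_even_part _.
have mB1 : measurable ([set x | 1 <= odd_part x] : set RR).
  by rewrite setE; exact: measurable_preimT measurable_odd_part _.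
have : unif A1 = (2^-1%:E * (unif set0 + unif [set x | (1 <= odd_part x)%R]))%E.
  apply: unif_half_eq => // x /andP[x0 x1]; rewrite /A1 /=.
    rewrite even_part_l//; split => // h.
    by have := even_part_le1 (half_shift x); rewrite -/(odd_part x); lra.
  by rewrite even_part_r//; split => h; lra.
have : unif [set x | 1 <= odd_part x] = (2^-1%:E * (unif A1 + unif A1))%E.
  apply: unif_half_eq => // x /andP[x0 x1]; rewrite /A1 /=.
    by rewrite odd_part_l.
  by rewrite odd_part_r.
rewrite measure0 add0e => ->.
rewrite -(fineK (unif_fin_num mA1)) -EFinD -!EFinM => -[h].
by congr EFin; lra.
Qed.

(** * The joint tail function of the even and odd parts, and their independence *)

Definition joint q r := unif [set x | q <= even_part x /\ r <= odd_part x].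

Lemma measurable_joint q r :
  measurable ([set x | q <= even_part x /\ r <= odd_part x] : set RR).
Proof.
have -> : [set x | q <= even_part x /\ r <= odd_part x] =
  (@even_part R) @^-1` `[q, +oo[%classic `&` (@odd_part R) @^-1` `[r, +oo[%classic.
  by apply/seteqP; split => x /=; rewrite !in_itv/= !andbT.
apply: measurableI; apply: measurable_preimT.
- exact: measurable_even_part.
- exact: measurable_itv.
- exact: measurable_odd_part.
- exact: measurable_itv.
Qed.

(** Removing the leading digit exchanges the two parts and doubles the threshold of the former even
    part. *)
Lemma joint_rec q r :
  joint q r = (2^-1%:E * (joint r (2 * q)%R + joint r (2 * q - 1)%R))%E.
Proof.
apply: unif_half_eq; first exact: measurable_joint.
- move=> x /andP[x0 x1] /=; rewrite even_part_l// odd_part_l//.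
  by split => -[? ?]; split => //; lra.
- move=> x /andP[x0 x1] /=; rewrite even_part_r// odd_part_r//.
  by split => -[? ?]; split => //; lra.
Qed.

Lemma joint_int q r : dyadic 0 q -> dyadic 0 r ->
  joint q r = (clamp q * clamp r)%:E.
Proof.
have small (s : R) : dyadic 0 s -> s <= 0 \/ 1 <= s.
  move=> [k]; rewrite expr0 mul1r => ->.
  have [k0|k0] := leP k 0; first by left; rewrite lerz0.
  by right; rewrite ler1z -gtz0_ge1.
have clamp0 s : s <= 0 -> clamp s = 1 :> R.
  by move=> s0; rewrite /clamp min_l ?max_r//; lra.
have clamp1 s : 1 <= s -> clamp s = 0 :> R.
  by move=> s0; rewrite /clamp min_r ?max_l//; lra.
have zero (s t : R) : 1 <= s -> joint s t = 0%E.
  move=> s1; apply/eqP; rewrite eq_le measure_ge0 andbT -unif_even_part1.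
  apply: le_measure; rewrite ?inE.
  - exact: measurable_joint.
  - have -> : [set x : R | 1 <= even_part x] =
        [set x : R | 1 <= even_part x /\ 0 <= odd_part x].
      by apply/seteqP; split => x /=; [split => //; exact: even_part_ge0|case].
    exact: measurable_joint.
  - by move=> x /= [h _]; exact: le_trans h.
move=> /small[q0|q1] /small[r0|r1].
- rewrite !clamp0// mulr1 -unifT; apply: unif_eq => x _; split => // _.
  by split; [exact: le_trans (even_part_ge0 _)|exact: le_trans (even_part_ge0 _)].
(* The recursion moves [r] to the first argument, where a threshold of at least 1 gives mass 0. *)
- by rewrite joint_rec !zero// (clamp1 r)// mulr0 adde0 mule0.
- by rewrite zero// (clamp1 q)// mul0r.
- by rewrite zero// (clamp1 q)// mul0r.
Qed.

Lemma dyadic_double n q : dyadic n.+1 q -> dyadic n (2 * q) /\ dyadic n (2 * q - 1).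
Proof.
rewrite /dyadic => -[k]; rewrite exprSr -mulrA => E; split; first by exists k.
exists (k - 2 ^+ n); by rewrite mulrBr E mulr1 intrB rmorphXn.
Qed.

Lemma joint_dyadic n q r : dyadic n q -> dyadic n r ->
  joint q r = (clamp q * clamp r)%:E.
Proof.
have rec q' r' : joint r' (2 * q') = (clamp r' * clamp (2 * q'))%:E ->
    joint r' (2 * q' - 1) = (clamp r' * clamp (2 * q' - 1))%:E ->
    joint q' r' = (clamp q' * clamp r')%:E.
  move=> h0 h1; rewrite joint_rec h0 h1 -EFinD -EFinM [clamp q']clamp_half.
  by congr EFin; ring.
elim: n q r => [|n IH] q r; first exact: joint_int.
(* One recursion lowers the level of the first argument only and swaps the pair, so each induction
   step takes two rounds, with this mixed case in between. *)
have K q' r' : dyadic n.+1 q' -> dyadic n r' -> joint q' r' = (clamp q' * clamp r')%:E.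
  by move=> /dyadic_double[? ?] ?; apply: rec; exact: IH.
by move=> /dyadic_double[? ?] ?; apply: rec; exact: K.
Qed.

(** Independence is known on pairs of dyadic rays. Fixing one factor at a time turns it into an
    equality of two finite measures on the line, first in [C], then in [D]. *)
Lemma even_odd_indep C D : measurable C -> measurable D ->
  unif (@even_part R @^-1` C `&` @odd_part R @^-1` D) = (unif C * unif D)%E.
Proof.
move=> mC mD.
have mray q : measurable (`[q, +oo[%classic : set RR) by exact: measurable_itv.
have step1 n r : dyadic n r ->
    unif (@even_part R @^-1` C `&` @odd_part R @^-1` `[r, +oo[) =
    (unif C * unif `[r, +oo[%classic)%E.
  move=> nr.
  have mB := measurable_preimT measurable_odd_part (mray r).
  have r0 : 0 <= clamp r by rewrite /clamp le_max lexx.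
  rewrite unif_ray muleC; apply: (@ray_measure_unique R
    (image_measure (mrestr unif mB) measurable_even_part) (mscale (NngNum r0) unif)
    _ _ C mC).
    rewrite /image_measure/= /pushforward/= /mrestr preimage_setT setTI.
    by rewrite (le_lt_trans (unif_le1 _))// ltry.
  move=> m q mq; rewrite /image_measure/= /pushforward /mrestr /mscale/=.
  rewrite unif_ray -EFinM mulrC -(@joint_dyadic (maxn m n)) /joint.
  - by congr (unif _); apply/seteqP; split => x /=; rewrite !in_itv/= !andbT.
  - by apply: dyadicW mq; exact: leq_maxl.
  - by apply: dyadicW nr; exact: leq_maxr.
have mA := measurable_preimT measurable_even_part mC.
have C0 : 0 <= fine (unif C) by rewrite fine_ge0.
rewrite setIC -(fineK (unif_fin_num mC)); apply: (@ray_measure_unique R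
  (image_measure (mrestr unif mA) measurable_odd_part) (mscale (NngNum C0) unif)
  _ _ D mD).
  rewrite /image_measure/= /pushforward/= /mrestr preimage_setT setTI.
  by rewrite (le_lt_trans (unif_le1 _))// ltry.
move=> n q nq.
rewrite -[LHS]/(unif (@odd_part R @^-1` `[q, +oo[ `&` @even_part R @^-1` C)).
rewrite -[RHS]/((fine (unif C))%:E * unif `[q, +oo[%classic)%E.
by rewrite setIC fineK ?unif_fin_num//; exact: step1 nq.
Qed.

Lemma unif_odd_part C : measurable C -> unif (@odd_part R @^-1` C) = unif C.
Proof.
move=> mC; have := even_odd_indep measurableT mC.
by rewrite preimage_setT setTI unifT mul1e.
Qed.

Lemma unif_half_shift C : measurable C -> unif (@half_shift R @^-1` C) = unif C.
Proof.
move=> mC; rewrite (@unif_half_eq C C).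
- by rewrite -(fineK (unif_fin_num mC)) -EFinD -EFinM; congr EFin; lra.
- exact: measurable_preimT measurable_half_shift _.
- by move=> x /andP[x0 x1]; rewrite /= half_shift_l.
- by move=> x /andP[x0 x1]; rewrite /= half_shift_r.
Qed.

End Baker.

(** * Parametrisation of the cubes *)

Section Coordinates.
Context {R : realType}.
Local Notation RR := (measurableTypeR R).
Local Notation unif := (@unif R).
Local Notation RN := (@Binf R).

(** On [good] points, digit k of coordinate [n] is digit 2^n (2k+1) - 1 of [x], so every digit of
    [x] is used by exactly one coordinate. *)
Definition ucoord n (x : R) : R := even_part (iter n (@odd_part R) x).

Lemma ucoordS n x : ucoord n.+1 x = ucoord n (odd_part x).
Proof. by rewrite /ucoord iterSr. Qed.

Lemma measurable_ucoord n : measurable_fun setT (ucoord n : RR -> RR).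
Proof.
apply: (measurableT_comp measurable_even_part).
exact: measurable_iter measurable_odd_part.
Qed.

Lemma measurable_forall d (T : measurableType d) (P : nat -> Prop) (E : nat -> set T) :
  (forall n, P n -> measurable (E n)) -> measurable [set x | forall n, P n -> E n x].
Proof.
move=> mE; rewrite (_ : mkset _ = \bigcap_(n in [set n | P n]) E n)//.
exact: bigcap_measurableType.
Qed.

(** Coordinate 0 depends on the even part and all later ones on the odd part, which is independent
    of it and again uniform in the induction. *)
Lemma unif_ucoords n (D : nat -> set RR) : (forall i, measurable (D i)) ->
  unif [set x | forall i, (i < n)%N -> D i (ucoord i x)] =
  (\big[*%E/1%E]_(i < n) unif (D i))%E.
Proof.
elim: n D => [|n IH] D mD.
  by rewrite big_ord0 -unifT; congr (unif _); apply/seteqP; split.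
rewrite big_ord_recl /= -(IH (fun i => D i.+1))// -even_odd_indep//; last first.
  apply: (@measurable_forall _ RR) => i _.
  exact: measurable_preimT (measurable_ucoord i) _.
congr (unif _); apply/seteqP; split => x /=.
  by move=> h; split => [|i ni]; [exact: (h 0%N)|rewrite -ucoordS; exact: h].
by move=> [h0 h] [//|i] ni; rewrite ucoordS; exact: h.
Qed.

Lemma measurable_translation (a : R) : measurable_fun setT (fun u : RR => a + u : RR).
Proof. exact: measurable_funD. Qed.

(** The translated uniform law is Lebesgue measure restricted to [a, a+1), as a comparison on rays
    shows. *)
Lemma unif_translation_le (a : R) (C : set RR) : measurable C ->
  (unif [set u | C (a + u)%R] <= lebesgue_measure C)%E.
Proof.
move=> mC.
have mI : measurable (`[a, a + 1[%classic : set RR) by exact: measurable_itv.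
have -> : unif [set u | C (a + u)] = mrestr (@lebesgue_measure R) mI C.
  apply: (@ray_measure_unique R (image_measure unif (measurable_translation a))
    (mrestr (@lebesgue_measure R) mI) _ _ C mC).
    by rewrite -[X in (X < _)%E]/(unif setT) unifT ltry.
  move=> _ q _; rewrite -[LHS]/(unif [set u | `[q, +oo[%classic (a + u)]).
  have -> : [set u | `[q, +oo[%classic (a + u)] = `[q - a, +oo[%classic.
    by apply/seteqP; split => x /=; rewrite !in_itv/= !andbT => ?; lra.
  rewrite unif_ray -[RHS]/(lebesgue_measure (`[q, +oo[ `&` `[a, a + 1[)).
  have -> : (`[q, +oo[ `&` `[a, a + 1[ = `[Num.max q a, a + 1[)%classic.
    apply/seteqP; split => x /=; rewrite !in_itv/= andbT ge_max.
      by case=> -> /andP[-> ->].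
    by move=> /andP[/andP[-> ->] ->].
  rewrite lebesgue_measure_itv/= lte_fin /clamp.
  have [qa|qa] := leP q a.
    rewrite ltrDl ltr01 min_l ?max_r//; last by lra.
    by rewrite -EFinB; congr EFin; lra.
  rewrite min_r; last by lra.
  have [q1|q1] := ltP q (a + 1); last by rewrite max_l//; lra.
  by rewrite max_r -?EFinB; [congr EFin; lra|lra].
by rewrite /mrestr; apply: le_measure; rewrite ?inE//; exact: measurableI.
Qed.

(** * Projections, rectangles and cubes of the sequence space *)

Lemma measurable_proj n : measurable_fun setT (fun y : RN => y n : RR).
Proof.
move=> _ C mC; rewrite setTI; apply: sub_sigma_algebra.
exists n.+1, (fun i => if i == n then C else setT); split.
  by move=> i; case: ifP.
apply/seteqP; split => y /=.
  by move=> Cy i _; case: eqP => // ->.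
by move=> /(_ n (ltnSn n)); rewrite eqxx.
Qed.

Lemma measurable_proj_preim n (C : set RR) : measurable C ->
  measurable [set y : RN | C (y n)].
Proof.
by move=> mC; rewrite -[X in measurable X]setTI; exact: measurable_proj.
Qed.

Lemma measurable_rect (C : nat -> set R) :
  (forall i, measurable (C i : set RR)) -> measurable (rect C : set RN).
Proof.
move=> mC; rewrite (_ : rect C = [set y | forall i, True -> C i (y i)]).
  by apply: (@measurable_forall _ RN) => i _; exact: measurable_proj_preim.
by apply/seteqP; split => y /= h i => [_|]; exact: h.
Qed.

Definition side (k : int) : set R := `[k%:~R, (k + 1)%:~R[%classic.

Lemma cube_rect (a : nat -> int) : cube a = rect (fun n => side (a n)).
Proof.
apply/seteqP; split => y /= h n.
  by rewrite /side/= in_itv/=; case: (h n) => -> ->.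
by have := h n; rewrite /side/= in_itv/= => /andP.
Qed.

Lemma measurable_cube (a : nat -> int) : measurable (cube a : set RN).
Proof. by rewrite cube_rect; apply: measurable_rect => i; exact: measurable_itv. Qed.

Definition param (a : nat -> int) (x : R) : RN := fun n => (a n)%:~R + ucoord n x.

Lemma measurable_to_RN d (T : measurableType d) (f : T -> RN) :
  (forall n, measurable_fun setT (fun x => f x n : RR)) -> measurable_fun setT f.
Proof.
move=> mf; apply: (@measurability _ _ T RN setT f (@cylinders R)) => //.
move=> _ [_ [m [C [mC ->]]] <-]; rewrite setTI.
apply: (@measurable_forall _ T (fun i => (i < m)%N) (fun i => [set x | C i (f x i)])).
by move=> i _; rewrite -[X in measurable X]setTI; exact: (mf i measurableT _ (mC i)).
Qed.

Lemma measurable_param a : measurable_fun setT (param a : RR -> RN).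
Proof.
apply: measurable_to_RN => n.
exact: (measurableT_comp (measurable_translation _) (measurable_ucoord n)).
Qed.

Lemma measurable_param_preim a (M : set RN) : measurable M ->
  measurable (param a @^-1` M : set RR).
Proof. by move=> mM; rewrite -[X in measurable X]setTI; exact: measurable_param. Qed.

(** Keeping only the first [n] constraints bounds the mass by the [n]-th partial product; the bound
    passes to the limit that defines [vol]. *)
Lemma param_rect_le a (C : nat -> set R) : finite_rect C ->
  (unif (param a @^-1` rect C) <= vol C)%E.
Proof.
move=> [mC [cvC _]]; apply: lime_ge => //; apply: nearW => n.
pose D i : set RR := [set u | C i ((a i)%:~R + u)].
have mD i : measurable (D i).
  rewrite -[X in measurable X]setTI.
  exact: (measurable_translation (a i)%:~R measurableT (mC i)).
apply: (@le_trans _ _ (unif [set x | forall i, (i < n)%N -> D i (ucoord i x)])).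
  apply: le_measure; rewrite ?inE.
  - apply: measurable_param_preim; exact: measurable_rect.
  - apply: (@measurable_forall _ RR) => i _.
    exact: measurable_preimT (measurable_ucoord i) _.
  - by move=> x /= h i _; exact: h.
rewrite unif_ucoords// /rect_pprod.
(* Nonnegativity of the partial product is carried along because multiplying the inequalities
   requires it. *)
suff : (0 <= \big[*%E/1]_(i < n) unif (D i) <=
        \big[*%E/1]_(i < n) lebesgue_measure (C i))%E by case/andP.
elim/big_rec2 : _ => [|i x y _ /andP[x0 xy]]; first by rewrite lee01 lexx.
rewrite mule_ge0//=; apply: lee_pmul => //.
exact: (unif_translation_le (a i)%:~R (mC i)).
Qed.

Lemma param_le_mu_star a (M : set RN) : measurable M ->
  (unif (param a @^-1` M) <= mu_star M)%E.
Proof.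
move=> mM; apply: le_ereal_inf_tmp => _ [Cs [fCs [MCs ->]]].
apply: (@le_trans _ _ (\sum_(0 <= n <oo) unif (param a @^-1` rect (Cs n)))%E).
  apply: measure_sigma_subadditive.
  - move=> n; apply: measurable_param_preim; apply: measurable_rect.
    by case: (fCs n).
  - exact: measurable_param_preim.
  - by move=> x /= /MCs[n _ h]; exists n.
by apply: lee_nneseries => n *; [exact: measure_ge0|exact: param_rect_le].
Qed.

Lemma vol_side a : vol (fun n => side (a n)) = 1%E /\ finite_rect (fun n => side (a n)).
Proof.
have E : rect_pprod (fun n => side (a n)) = cst (1%E : \bar R).
  apply/funext => n; rewrite /rect_pprod big1// => i _.
  rewrite /side lebesgue_measure_itv/= lte_fin ltr_int ltzD1 lexx -EFinB.
  by rewrite intrD addrAC subrr add0r.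
have cE : rect_pprod (fun n => side (a n)) @ \oo --> 1%E by rewrite E; exact: cvg_cst.
have vE : vol (fun n => side (a n)) = 1%E by apply/cvg_lim.
split=> //; split; [by move=> i; exact: measurable_itv|split].
  by apply/cvg_ex; exists 1%E.
by rewrite vE.
Qed.

Lemma vol_set0 : vol (fun=> @set0 R) = 0%E /\ finite_rect (fun=> @set0 R).
Proof.
have cE : rect_pprod (fun=> @set0 R) @ \oo --> 0%E.
  (* The empty product at index 0 is 1; from index 1 on the products vanish. *)
  rewrite -cvg_shiftS; rewrite (_ : (fun _ => _) = cst 0%E); first exact: cvg_cst.
  by apply/funext => n; rewrite /rect_pprod big_ord_recl measure0 mul0e.
have vE : vol (fun=> @set0 R) = 0%E by apply/cvg_lim.
split=> //; split => //; split; first by apply/cvg_ex; exists 0%E.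
by rewrite vE.
Qed.

Lemma mu_star_cube_le1 a : (mu_star (cube a : set RN) <= 1)%E.
Proof.
apply: ereal_inf_lbound.
(* Covers are infinite sequences, so the cube itself is padded with empty rectangles of volume 0. *)
exists (fun n => if n is 0%N then fun i => side (a i) else fun=> set0); split.
  by case=> [|n]; [case: (vol_side a)|case: vol_set0].
split; first by rewrite cube_rect => y ay; exists 0%N.
rewrite (@nneseriesD1 _ _ 0%N)//; last first.
  by case=> [|n] *; [rewrite (vol_side a).1|rewrite vol_set0.1].
by rewrite (vol_side a).1 eseries0 ?adde0// => -[|n]// _ _; rewrite vol_set0.1.
Qed.

(** The points at which every digit can be read off from the coordinates; they have full measure by
    [unif_good]. *)
Definition good : set R := [set x | forall n, generic (iter n (@odd_part R) x)].

Lemma measurable_generic : measurable ([set x | generic x] : set RR).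
Proof.
rewrite (_ : mkset _ = `[0, 1[%classic `&` [set x | forall n, True ->
    ((@even_part R \o iter n (@half_shift R)) @^-1` `]-oo, 1[%classic) x]).
  apply: measurableI; first exact: measurable_itv.
  apply: (@measurable_forall _ RR) => n _.
  apply: (@measurable_preimT R (@even_part R \o iter n (@half_shift R))).
    exact: (measurableT_comp measurable_even_part
      (measurable_iter n measurable_half_shift)).
  exact: measurable_itv.
apply/seteqP; split => x /=; rewrite in_itv/=.
  by move=> [x01 h]; split => // n _; rewrite in_itv/=.
by move=> [x01 h]; split => // n; have := h n Logic.I; rewrite in_itv.
Qed.

Lemma measurable_good : measurable (good : set RR).
Proof.
rewrite (_ : good = [set x | forall n, True ->
    (iter n (@odd_part R) @^-1` [set x | generic x]) x]).
  apply: (@measurable_forall _ RR) => n _.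
  apply: (@measurable_preimT R (iter n (@odd_part R))).
    exact: measurable_iter measurable_odd_part.
  exact: measurable_generic.
by apply/seteqP; split => x /= h n => [_|]; exact: h.
Qed.

Lemma unif_iter_preserve (f : RR -> RR) n C : measurable_fun setT f ->
  (forall C, measurable C -> unif (f @^-1` C) = unif C) ->
  measurable C -> unif (iter n f @^-1` C) = unif C.
Proof.
move=> mf fP; elim: n C => [//|n IH] C mC.
rewrite -[LHS]/(unif (iter n f @^-1` (f @^-1` C))) IH ?fP//.
exact: measurable_preimT.
Qed.

Lemma unif_bigcup0 (E : nat -> set RR) (F : set RR) : measurable F ->
  (forall n, measurable (E n)) -> (forall n, unif (E n) = 0%E) ->
  F `<=` \bigcup_n E n -> unif F = 0%E.
Proof.
move=> mF mE E0 FE; apply/eqP; rewrite eq_le measure_ge0 andbT.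
rewrite (le_trans (measure_sigma_subadditive unif mE mF FE))// eseries0//.
Qed.

Lemma unif_generic : unif (~` [set x | generic x]) = 0%E.
Proof.
have mG := measurableC measurable_generic.
(* Index 0 collects the points outside [0,1); index n'+1 the failure of the [n']-th strict
   inequality, a preimage of a null set under a measure-preserving map. *)
pose E n : set RR := if n is n'.+1 then
  iter n' (@half_shift R) @^-1` (@even_part R @^-1` `[1, +oo[%classic)
  else ~` `[0, 1[%classic.
have mA : measurable (@even_part R @^-1` `[1, +oo[%classic : set RR).
  by apply: measurable_preimT; [exact: measurable_even_part|exact: measurable_itv].
apply: (@unif_bigcup0 E) => //.
- case=> [|n]; first by apply: measurableC; exact: measurable_itv.
  apply: measurable_preimT => //; exact: measurable_iter measurable_half_shift.
- case=> [|n].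
    by rewrite -(measure0 unif); apply: unif_eq => x x01; split.
  rewrite /E unif_iter_preserve//; last 2 first.
  - exact: measurable_half_shift.
  - exact: unif_half_shift.
  rewrite -unif_even_part1; congr (unif _).
  by apply/seteqP; split => x /=; rewrite in_itv/= andbT.
- move=> x /= ngx; apply: contrapT => nE; apply: ngx; split.
    by apply: contrapT => n01; apply: nE; exists 0%N => //=; rewrite in_itv/=.
  move=> n; rewrite ltNge; apply/negP => h; apply: nE.
  by exists n.+1 => //=; rewrite in_itv/= andbT.
Qed.

Lemma unif_good : unif (~` good) = 0%E.
Proof.
have mG := measurableC measurable_generic.
apply: (@unif_bigcup0 (fun n => iter n (@odd_part R) @^-1` (~` [set x | generic x]))).
- exact: measurableC measurable_good.
- by move=> n; apply: measurable_preimT => //; exact: measurable_iter measurable_odd_part.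
- move=> n; rewrite unif_iter_preserve ?unif_generic//.
    exact: measurable_odd_part.
  exact: unif_odd_part.
- by move=> x /= /existsNP[n ngx]; exists n.
Qed.

Lemma param_cube a x : good x -> cube a (param a x).
Proof.
move=> gx n; rewrite /param lerDl intrD ltrD2l; split; first exact: even_part_ge0.
by have := (gx n).2 0%N.
Qed.

Lemma unif_param_cube a : unif (param a @^-1` cube a) = 1%E.
Proof.
have mp := measurable_param_preim a (measurable_cube a).
apply/eqP; rewrite eq_le unif_le1//= -unifT.
have := measureDI unif measurableT mp; rewrite setTI setTD => ->.
rewrite [X in (X + _)%E](_ : _ = 0)%E ?add0e//.
apply/eqP; rewrite eq_le measure_ge0 andbT -unif_good.
apply: le_measure; rewrite ?inE.
- exact: measurableC.
- exact: measurableC measurable_good.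
- by apply: subsetC => x; exact: param_cube.
Qed.

(* Both measures give the cube mass 1, so the inequality of [param_le_mu_star],
   applied to a set and to its complement in the cube, is an equality. *)
Lemma mu_param (mu : {measure set RN -> \bar R}) :
  (forall A : set RN, measurable A -> mu A = mu_star A) ->
  forall a (M : set RN), measurable M -> M `<=` cube a ->
  mu M = unif (param a @^-1` M).
Proof.
move=> muE a M mM Ma.
have mC := measurable_cube a.
have muC : (mu (cube a) <= 1)%E by rewrite muE// mu_star_cube_le1.
have mD : measurable (cube a `\` M) by exact: measurableD.
have ge N : measurable N -> (unif (param a @^-1` N) <= mu N)%E.
  by move=> mN; rewrite muE//; exact: param_le_mu_star.
have e1 := measureDI mu mC mM.
have e2 : (1 = unif (param a @^-1` (cube a `\` M)) + unif (param a @^-1` M))%E.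
  rewrite -(unif_param_cube a).
  rewrite (measureDI unif (measurable_param_preim a mC) (measurable_param_preim a mM)).
  by rewrite -preimage_setI setIidr.
rewrite setIidr// in e1.
have gM := ge _ mM; have gD := ge _ mD.
apply/eqP; rewrite eq_le gM andbT.
have fD : unif (param a @^-1` (cube a `\` M)) \is a fin_num.
  by apply: unif_fin_num; exact: measurable_param_preim.
rewrite -(leeD2lE _ _ fD) -e2 (le_trans _ muC)// e1.
exact: leeD.
Qed.

End Coordinates.

(** * Inverse parametrisation and the index set *)

Section Decode.
Context {R : realType}.
Local Notation RR := (measurableTypeR R).
Local Notation unif := (@unif R).
Local Notation RN := (@Binf R).

Lemma good_odd_part x : good x -> good (odd_part x : R).
Proof. by move=> gx n; rewrite -iterSr; exact: gx. Qed.

(** Strong induction on the position: an even one is a digit of coordinate 0, an odd one is a digit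
    at about half the position of [odd_part x], whose coordinates are the shifted sequence. *)
Lemma digit_of_ucoords m : exists d : RN -> R,
  [/\ measurable_fun setT d, (forall y, 0 <= d y <= 1) &
      forall x, good x -> d (ucoord ^~ x) = digit m x].
Proof.
elim/ltn_ind: m => m IH.
have := odd_double_half m; case: (boolP (odd m)) => om mE; last first.
  exists (fun y => digit m./2 (y 0%N)); split.
  - exact: (measurableT_comp (measurable_digit _) (@measurable_proj R 0%N)).
  - by move=> y; exact: (digit01 _ (fun=> m./2) 0%N).
  - by move=> x gx; rewrite (digit_even_part _ (gx 0%N)) -[in RHS]mE.
have [|d [md d01 dE]] := IH m./2; first by rewrite -[ltnRHS]mE -addnn ltnS leq_addr.
exists (fun y => d (fun n => y n.+1)); split.
- apply: (measurableT_comp md); apply: measurable_to_RN => n; exact: measurable_proj.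
- by move=> y; exact: d01.
- move=> x gx; rewrite (_ : (fun n => _) = ucoord ^~ (odd_part x)).
    rewrite dE; last exact: good_odd_part.
    by rewrite (digit_odd_part _ (gx 0%N)) -[in RHS]mE.
  by apply/funext => n; rewrite ucoordS.
Qed.

Lemma ucoords_inverse : exists r : RN -> R,
  measurable_fun setT r /\ forall x, good x -> r (ucoord ^~ x) = x.
Proof.
have /choice[d dP] := digit_of_ucoords.
exists (fun y => bin_val (d ^~ y)); split.
  apply: measurable_bin_val; first by move=> n; case: (dP n).
  by move=> y n; case: (dP n).
move=> x gx; rewrite -[RHS]bin_val_digit; last by case: (gx 0%N).
by congr bin_val; apply/funext => n; case: (dP n) => _ _ ->.
Qed.

Lemma param_inverse : exists r : (nat -> int) -> RN -> R,
  (forall a, measurable_fun setT (r a)) /\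
  forall a x, good x -> r a (param a x) = x.
Proof.
have [r [mr rE]] := ucoords_inverse.
exists (fun a y => r (fun n => y n - (a n)%:~R)); split.
  move=> a; apply: (measurableT_comp mr); apply: measurable_to_RN => n.
  by apply: measurable_funB; [exact: measurable_proj|exact: measurable_cst].
move=> a x gx; rewrite -[RHS]rE//; congr r.
by apply/funext => n; rewrite /param addrC addKr.
Qed.

Lemma cube_inj (a b : nat -> int) (y : RN) : cube a y -> cube b y -> a = b.
Proof.
move=> ay by_; apply/funext => n.
have [a1 a2] := ay n; have [b1 b2] := by_ n.
by rewrite -(@floor_def _ (y n) (a n)) ?a1// -(@floor_def _ (y n) (b n)) ?b1.
Qed.

(** Interleaving bits with zeros gives a base 4 expansion with digits 0 and 2, which avoids the
    double expansions of base 2. *)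
Definition sparse (b : nat -> bool) (n : nat) : R :=
  if odd n then 0 else (b n./2)%:R.

Lemma sparse01 b : digits01 (sparse b).
Proof.
move=> n; rewrite /sparse; case: ifP => _; rewrite ?lexx ?ler01//.
by case: (b _); rewrite ?lexx ?ler01.
Qed.

Lemma sparse_rec b : bin_val (sparse b) =
  (b 0%N)%:R / 2 + bin_val (sparse (fun n => b n.+1)) / 4.
Proof.
rewrite bin_val_rec; last exact: sparse01.
rewrite bin_val_rec; last by move=> n; exact: sparse01.
rewrite (_ : (fun n => _) = sparse (fun n => b n.+1)); last first.
  by apply/funext => n; rewrite /sparse /= negbK.
rewrite /sparse /=; lra.
Qed.

Lemma sparse_inj : injective (fun b => bin_val (sparse b)).
Proof.
(* The tails contribute at most 1/4 and the leading bit contributes 0 or 1/2, so the value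
   determines the leading bit. *)
have head b c : bin_val (sparse b) = bin_val (sparse c) ->
    b 0%N = c 0%N /\
    bin_val (sparse (fun n => b n.+1)) = bin_val (sparse (fun n => c n.+1)).
  rewrite sparse_rec (sparse_rec c).
  have := bin_val_ge0 (sparse01 (fun n => b n.+1)).
  have := bin_val_le1 (sparse01 (fun n => b n.+1)).
  have := bin_val_ge0 (sparse01 (fun n => c n.+1)).
  have := bin_val_le1 (sparse01 (fun n => c n.+1)).
  by case: (b 0%N) (c 0%N) => -[]/= *; split => //; lra.
move=> b c bc; apply/funext => n.
by elim: n b c bc => [|n IH] b c /head[]//= _ /IH.
Qed.

(** The characteristic function of the graph of [a], pulled back to nat by a countable encoding of
    pairs. *)
Definition graph_code (a : nat -> int) (m : nat) : bool :=
  if unpickle m is Some nk then a nk.1 == nk.2 else false.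

Lemma graph_code_inj : injective graph_code.
Proof.
move=> a b ab; apply/funext => n.
have := congr1 (fun f => f (pickle (n, a n))) ab.
by rewrite /graph_code pickleK/= eqxx => /esym/eqP.
Qed.

Lemma floors_inj : injective (fun (x : R) n => Num.floor (2 ^+ n * x)).
Proof.
suff lt (x y : R) :
    (fun n => Num.floor (2 ^+ n * x)) = (fun n => Num.floor (2 ^+ n * y)) -> ~ x < y.
  move=> x y xy; apply/eqP; rewrite eq_le !leNgt.
  by apply/andP; split; apply/negP; apply: lt.
move=> E xy; have [n] := dyadic_floor_gt xy.
rewrite /dyadic_floor -(congr1 (fun f => f n) E).
by rewrite ltNge dyadic_floor_le.
Qed.

(** Cantor-Bernstein: integer sequences embed in the reals by sparse expansions of their graphs, and
    reals embed by their scaled floors. *)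
Lemma int_seq_continuum : exists e : R -> nat -> int, bijective e.
Proof.
have inj_le (T : Type) (U : pointedType) (f : T -> U) :
    injective f -> ([set: T] #<= [set: U])%card.
  by move=> fI; apply/pcard_injP; exists f => x y _ _; exact: fI.
have : ([set: nat -> int] #= [set: R])%card.
  rewrite card_eq_le; apply/andP; split.
    apply: (inj_le _ _ (fun a => bin_val (sparse (graph_code a)))).
    by move=> a b /sparse_inj/graph_code_inj.
  pose U : pointedType := HB.pack (nat -> int) (gen_eqMixin (nat -> int))
    (gen_choiceMixin (nat -> int)) (isPointed.Build (nat -> int) (fun=> 0)).
  exact: (inj_le R U _ floors_inj).
move=> /card_set_bijP[f]; rewrite setTT_bijective => -[g fK gK].
by exists g; exists f.
Qed.

End Decode.

(** * Integrals over unions of cubes *)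

Section SumsOfIntegrals.
Context {R : realType}.
Local Open Scope ereal_scope.

Lemma esum_countable_support (T : choiceType) (a : T -> \bar R) :
  (forall t, 0 <= a t) -> \esum_(t in [set: T]) a t < +oo ->
  countable [set t | a t != 0].
Proof.
move=> a0 aoo.
have sfin : \esum_(t in [set: T]) a t \is a fin_num.
  by rewrite ge0_fin_numE// esum_ge0.
have afin t : a t \is a fin_num.
  rewrite ge0_fin_numE//; apply: le_lt_trans aoo.
  by apply: esum_ge; exists [set t] => //; rewrite fsbig_set1.
rewrite [X in countable X](_ : _ = \bigcup_n [set t | (n.+1%:R^-1)%:E < a t]); last first.
  apply/seteqP; split=> [t/= at0|t/= [k _ kt]]; last first.
    by rewrite gt_eqF// (le_lt_trans _ kt)// lee_fin invr_ge0.
  have /ltr_add_invr[k] : (0 < fine (a t))%R.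
    by rewrite fine_gt0// lt_def at0 a0 ltey_eq afin.
  by rewrite add0r => kt; exists k => //=; rewrite -(fineK (afin t)) lte_fin.
apply: bigcup_countable => // n _; apply: finite_set_countable.
apply: contrapT => /infinite_set_fset.
set S := fine (\esum_(t in [set: T]) a t).
(* With more than S (n+1) terms above 1/(n+1), a finite partial sum would exceed the total S. *)
move=> /(_ (Num.bound `|S * n.+1%:R|%R))[B BA cB].
have : \sum_(t \in [set` B]) a t <= S%:E.
  by rewrite fineK//; apply: esum_ge; exists [set` B].
rewrite fsbig_finite//= set_fsetK leNgt => /negP; apply.
apply: (@lt_le_trans _ _ (\sum_(t <- B) (n.+1%:R^-1)%:E)); last first.
  by rewrite !big_seq; apply: lee_sum => t tB; apply: ltW; exact: BA.
rewrite sumEFin lte_fin big_const_seq count_predT iter_addr_0.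
rewrite -[ltRHS]mulr_natl ltr_pdivlMr// (le_lt_trans (ler_norm _))//.
by rewrite (lt_le_trans (archi_boundP (normr_ge0 _)))// ler_nat.
Qed.

Lemma cubes_enum (D : set (nat -> int)) : countable D ->
  exists (f : (nat -> int) -> nat) (G : nat -> set (@Binf R)),
  [/\ {in D &, injective f}, (forall a, D a -> G (f a) = cube a),
      (forall n, ~ (f @` D) n -> G n = set0),
      \bigcup_(a in D) cube a = \bigcup_n G n & trivIset setT G].
Proof.
move=> /countable_injP[f finj].
pose G n : set (@Binf R) := \bigcup_(a in [set a | D a /\ f a = n]) cube a.
have GE a : D a -> G (f a) = cube a.
  move=> Da; apply/seteqP; split => [y [b [Db fba] by_]|y ay]; last by exists a.
  by rewrite -(finj b a (mem_set Db) (mem_set Da) fba).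
exists f, G; split => //.
- move=> n nD; apply/seteqP; split => // y [a [Da fan] _]; apply: nD.
  by exists a.
- apply/seteqP; split => [y [a Da ay]|y [n _ [a [Da _] ay]]].
    by exists (f a) => //; rewrite GE.
  by exists a.
- apply/trivIsetP => n m _ _ nm.
  apply/seteqP; split => // y [[a [Da fa] ay] [b [Db fb] by_]].
  by move: nm; rewrite -fa -fb (cube_inj ay by_) eqxx.
Qed.

Lemma measurable_enum_cubes (D : set (nat -> int)) f (G : nat -> set (@Binf R)) :
  (forall a, D a -> G (f a) = cube a) ->
  (forall n, ~ (f @` D) n -> G n = set0) -> forall n, measurable (G n).
Proof.
move=> GE GNE n; have [[a Da <-]|/GNE->//] := pselect ((f @` D) n).
by rewrite GE//; exact: measurable_cube.
Qed.

Lemma measurable_cubes (D : set (nat -> int)) : countable D ->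
  measurable (\bigcup_(a in D) cube a : set (@Binf R)).
Proof.
move=> /cubes_enum[f [G [_ GE GNE -> _]]].
by apply: bigcupT_measurable; exact: measurable_enum_cubes GE GNE.
Qed.

Lemma measurable_fun_cubes (D : set (nat -> int)) (h : @Binf R -> R) :
  countable D -> (forall a, D a -> measurable_fun (cube a) h) ->
  measurable_fun (\bigcup_(a in D) cube a) h.
Proof.
move=> /cubes_enum[f [G [_ GE GNE -> _]]] mh.
apply/measurable_fun_bigcup; first exact: measurable_enum_cubes GE GNE.
move=> n; have [[a Da <-]|/GNE->] := pselect ((f @` D) n).
  by rewrite GE//; exact: mh.
exact: measurable_fun_set0.
Qed.

Lemma integral_cubes (mu : {measure set (@Binf R) -> \bar R}) (D : set (nat -> int))
    (g : @Binf R -> \bar R) : countable D ->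
  measurable_fun setT g -> (forall y, 0 <= g y) ->
  \int[mu]_(y in \bigcup_(a in D) cube a) g y = \esum_(a in D) \int[mu]_(y in cube a) g y.
Proof.
move=> /cubes_enum[f [G [finj GE GNE -> tG]]] mg g0.
have mG := measurable_enum_cubes GE GNE.
rewrite ge0_integral_bigcup//; last exact: measurable_funTS.
rewrite nneseries_esumT; last by move=> n; exact: integral_ge0.
rewrite (eq_esum (b := fun a => \int[mu]_(y in G (f a)) g y)); last first.
  by move=> a Da; rewrite GE.
rewrite -(esum_image _ _ (fun n => \int[mu]_(y in G n) g y) finj).
rewrite [RHS]esum_mkcond; apply: eq_esum => n _.
case: ifPn => //; rewrite notin_setE => /GNE->.
by rewrite integral_set0.
Qed.

(** The sum is a supremum over finite subfamilies, so no countability is assumed; the countability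
    of [Oset] is deduced from this bound. *)
Lemma esum_cubes_le (mu : {measure set (@Binf R) -> \bar R}) (g : @Binf R -> \bar R) :
  measurable_fun setT g -> (forall y, 0 <= g y) ->
  \esum_(a in [set: nat -> int]) \int[mu]_(y in cube a) g y <= \int[mu]_y g y.
Proof.
move=> mg g0; apply: ge_ereal_sup => _ [X [finX _] <-].
rewrite -esum_fset//; last by move=> a _; exact: integral_ge0.
have cX := finite_set_countable finX.
rewrite -integral_cubes//; apply: ge0_subset_integral => //.
exact: measurable_cubes.
Qed.

Lemma integral_cube_param (mu : {measure set (@Binf R) -> \bar R}) :
  (forall A : set (@Binf R), measurable A -> mu A = mu_star A) ->
  forall a (g : @Binf R -> \bar R), measurable_fun setT g -> (forall y, 0 <= g y) ->
  \int[mu]_(y in cube a) g y = \int[lam01]_x g (param a x).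
Proof.
move=> muE a g mg g0.
have mC := @measurable_cube R a; have mP := measurable_param_preim a mC.
rewrite (eq_measure_integral (image_measure unif (measurable_param a))); last first.
  by move=> A mA Aa; exact: mu_param.
rewrite (ge0_integral_pushforward (measurable_param a))//; last exact: measurable_funTS.
(* The parametrisation leaves the cube only on a null set, so the integral over the preimage of the
   cube extends to the whole line. *)
transitivity (\int[unif]_x g (param a x)).
  apply/esym; transitivity
      (\int[unif]_(x in setT `\` ~` (param a @^-1` cube a)) g (param a x)); last first.
    by rewrite setDE setCK setTI.
  apply: ge0_negligible_integral => //.
  - exact: measurableC.
  - exact: (measurableT_comp mg (measurable_param a)).
  - by apply: unif_setC0; [exact: mP|exact: unif_param_cube].
by apply: eq_measure_integral => A mA _; exact/esym/lam01_unif.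
Qed.

End SumsOfIntegrals.

(** * The decomposition *)

Section PowerIntegrals.
Context d (T : measurableType d) (R : realType) (m : {measure set T -> \bar R}).
Variables (p : R) (p0 : (0 < p)%R).
Local Open Scope ereal_scope.
Implicit Types f g : T -> R.

Lemma Lnorm_EFin f :
  'N[m]_p%:E [EFin \o f] = (\int[m]_x (`|f x| `^ p)%:E) `^ p^-1.
Proof. by rewrite unlock. Qed.

Lemma Lnorm_EFin_pow f :
  'N[m]_p%:E [EFin \o f] `^ p = \int[m]_x (`|f x| `^ p)%:E.
Proof. by rewrite poweR_Lnorm// gt_eqF. Qed.

Lemma Lfun_powP f : f \in Lfun m p%:E <->
  measurable_fun setT f /\ \int[m]_x (`|f x| `^ p)%:E < +oo.
Proof.
split.
  case/andP; rewrite !inE/= /finite_norm Lnorm_EFin => mf foo; split => //.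
  by apply: lty_poweRy foo; rewrite invr_neq0// gt_eqF.
move=> [mf foo]; apply/andP; split; rewrite inE//=.
by rewrite /finite_norm Lnorm_EFin poweR_lty.
Qed.

Lemma measurable_pow f : measurable_fun setT f ->
  measurable_fun setT (fun x => (`|f x| `^ p)%:E).
Proof.
move=> mf; apply/measurable_EFinP.
apply: (measurableT_comp (measurable_powR p)); exact: measurableT_comp.
Qed.

Lemma pow_ge0 f x : 0 <= (`|f x| `^ p)%:E.
Proof. by rewrite lee_fin powR_ge0. Qed.

End PowerIntegrals.

(** Identities obtained by inverting the parametrisation hold at good points only, which is enough
    under the integral. *)
Lemma integral_lam01_good (R : realType) (g h : R -> \bar R) :
  measurable_fun setT (g : measurableTypeR R -> _) ->
  measurable_fun setT (h : measurableTypeR R -> _) ->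
  (forall x, 0 <= g x)%E -> (forall x, 0 <= h x)%E ->
  (forall x, good x -> g x = h x) ->
  (\int[lam01]_x g x = \int[lam01]_x h x)%E.
Proof.
move=> mg mh g0 h0 gh; apply: ge0_ae_eq_integral => //.
have mN := measurableC (@measurable_good R).
exists (~` good); split; first exact: mN.
  exact: etrans (lam01_unif mN) unif_good.
by apply: subsetC => x gx _; exact: gh.
Qed.

Section Decomposition.
Context (R : realType) (mu : {measure set (@Binf R) -> \bar R}).
Variables (p : R) (p0 : (0 < p)%R).
Local Open Scope ereal_scope.
Implicit Types f g h : @Binf R -> R.

Lemma cube_int_ge0 f a : 0 <= cube_int mu p f a.
Proof. by apply: integral_ge0 => y _; exact: pow_ge0. Qed.

Lemma countable_Oset f : f \in Lfun mu p%:E -> countable (Oset mu p f).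
Proof.
move=> /(Lfun_powP _ p0)[mf foo].
apply: esum_countable_support; first exact: cube_int_ge0.
apply: le_lt_trans foo; apply: esum_cubes_le; first exact: measurable_pow.
by move=> y; exact: pow_ge0.
Qed.

Lemma esum_Oset f : \esum_(a in [set: nat -> int]) cube_int mu p f a =
  \esum_(a in Oset mu p f) cube_int mu p f a.
Proof.
rewrite [RHS]esum_mkcond; apply: eq_esum => a _.
by case: ifPn => //; rewrite notin_setE /Oset/= => /negP; rewrite negbK => /eqP.
Qed.

Lemma cube_int_eq0 h a : (forall y, cube a y -> h y = 0%R) -> cube_int mu p h a = 0.
Proof.
move=> h0; apply: integral0_eq => y ay.
by rewrite h0// normr0 powR0// gt_eqF.
Qed.

Lemma inG_supported h (D : set (nat -> int)) : measurable_fun setT h ->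
  countable D -> (forall y, ~ (\bigcup_(a in D) cube a) y -> h y = 0%R) ->
  \esum_(a in D) cube_int mu p h a < +oo -> inG mu p h.
Proof.
move=> mh cD hD hoo.
have Dh a : ~ D a -> cube_int mu p h a = 0.
  move=> nDa; apply: cube_int_eq0 => y ay; apply: hD => -[b Db by_].
  by apply: nDa; rewrite (cube_inj ay by_).
have OD : Oset mu p h `<=` D.
  by move=> a /eqP ah; apply: contrapT => /Dh.
have cO : countable (Oset mu p h).
  exact: sub_countable (subset_card_le OD) cD.
have hE : \int[mu]_y (`|h y| `^ p)%:E = \esum_(a in D) cube_int mu p h a.
  rewrite /cube_int -(integral_cubes mu cD (measurable_pow p mh) (pow_ge0 p h)).
  rewrite [RHS]integral_mkcond; apply: eq_integral => y _; rewrite patchE.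
  case: ifPn => //; rewrite notin_setE => /hD ->.
  by rewrite normr0 powR0// gt_eqF.
have DE : \esum_(a in D) cube_int mu p h a = \esum_(a in Oset mu p h) cube_int mu p h a.
  rewrite -esum_Oset [LHS]esum_mkcond; apply: eq_esum => a _.
  by case: ifPn => //; rewrite notin_setE => /Dh.
split; first by apply/(Lfun_powP _ p0); split => //; rewrite hE.
rewrite hE DE; split => //.
by rewrite /Fset (integral_cubes mu cO (measurable_pow p mh) (pow_ge0 p h)).
Qed.

Lemma le_cube_int f g a : measurable_fun setT f -> measurable_fun setT g ->
  (forall y, `|f y| <= `|g y|)%R -> cube_int mu p f a <= cube_int mu p g a.
Proof.
move=> mf mg fg; apply: ge0_le_integral.
- exact: measurable_cube.
- by move=> y _; exact: pow_ge0.
- by apply: measurable_funTS; exact: measurable_pow.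
- by apply: measurable_funTS; exact: measurable_pow.
- by move=> y _; rewrite lee_fin ge0_ler_powR// ?nnegrE// ltW.
Qed.

Lemma Lfun_decomp f : f \in Lfun mu p%:E ->
  exists g b, [/\ inG mu p g, inB mu p b, f = (fun x => g x + b x)%R
    & Lpnorm mu p g <= Lpnorm mu p f].
Proof.
move=> fL; have [mf foo] := (Lfun_powP mu p0 f).1 fL.
have cO := countable_Oset fL.
have mF : measurable (Fset mu p f) by exact: measurable_cubes.
pose g y := (f y * \1_(Fset mu p f) y)%R.
pose b y := (f y - g y)%R.
have mg : measurable_fun setT g by apply: measurable_funM => //; exact: measurable_indic.
have mb : measurable_fun setT b by exact: measurable_funB.
have gF y : ~ Fset mu p f y -> g y = 0%R.
  by move=> nF; rewrite /g indicE memNset// mulr0.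
have bF y : Fset mu p f y -> b y = 0%R.
  by move=> nF; rewrite /b /g indicE mem_set// mulr1 subrr.
have gf y : (`|g y| <= `|f y|)%R.
  by rewrite /g indicE; case: (_ \in _); rewrite ?mulr1// mulr0 normr0.
have bf y : (`|b y| <= `|f y|)%R.
  by rewrite /b /g indicE; case: (_ \in _); rewrite ?mulr1 ?subrr ?normr0// mulr0 subr0.
have powle h : measurable_fun setT h -> (forall y, `|h y| <= `|f y|)%R ->
    \int[mu]_y (`|h y| `^ p)%:E <= \int[mu]_y (`|f y| `^ p)%:E.
  move=> mh hf; apply: ge0_le_integral; first exact: measurableT.
  - by move=> y _; exact: pow_ge0.
  - exact: measurable_pow.
  - exact: measurable_pow.
  - by move=> y _; rewrite lee_fin ge0_ler_powR// ?nnegrE// ltW.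
exists g, b; split.
- apply: (@inG_supported _ (Oset mu p f)) => //.
  apply: le_lt_trans foo.
  apply: le_trans (esum_cubes_le mu (measurable_pow p mf) _); last first.
    by move=> y; exact: pow_ge0.
  rewrite esum_Oset; apply: le_esum => a _; exact: le_cube_int.
- split.
    by apply/(Lfun_powP _ p0); split => //; apply: le_lt_trans foo; exact: powle.
  (* On cubes of [Oset] the remainder vanishes identically; on the others it is dominated by [f],
     whose integral there is 0. *)
  move=> a; have [aO|aO] := pselect (Oset mu p f a).
    by apply: cube_int_eq0 => y ay; apply: bF; exists a.
  apply/eqP; rewrite eq_le cube_int_ge0 andbT.
  have <- : cube_int mu p f a = 0 by apply/eqP; apply: contrapT => /negP.
  exact: le_cube_int.
- by apply/funext => y; rewrite /b addrC subrK.
- rewrite /Lpnorm !Lnorm_EFin; apply: gt0_ler_poweR => //.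
  + by rewrite invr_ge0 ltW.
  + by rewrite in_itv/= leey andbT integral_ge0// => y _; exact: pow_ge0.
  + by rewrite in_itv/= leey andbT integral_ge0// => y _; exact: pow_ge0.
  + exact: powle.
Qed.

Lemma inG_inB_norm0 g : inG mu p g -> inB mu p g -> Lpnorm mu p g = 0.
Proof.
move=> [_ [gE _]] [_ gB]; rewrite /Lpnorm Lnorm_EFin gE.
rewrite esum1; first by rewrite poweR0r// invr_neq0// gt_eqF.
by move=> a _; exact: gB.
Qed.

End Decomposition.

(** * The isomorphism *)

Section Isomorphism.
Context (R : realType) (mu : {measure set (@Binf R) -> \bar R}).
Hypothesis mu_def : forall A : set (@Binf R), measurable A -> mu A = mu_star A.
Variables (p : R) (p0 : (0 < p)%R).
Variables (e : R -> nat -> int) (e' : (nat -> int) -> R).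
Hypotheses (eK : cancel e e') (e'K : cancel e' e).
Local Open Scope ereal_scope.
Local Notation RR := (measurableTypeR R).

Definition restrictions (f : @Binf R -> R) (k x : R) : R := f (param (e k) x).

Lemma measurable_restrictions f k : measurable_fun setT f ->
  measurable_fun setT (restrictions f k : RR -> R).
Proof. by move=> mf; exact: (measurableT_comp mf (measurable_param (e k))). Qed.

Lemma restrictions_norm f k : measurable_fun setT f ->
  'N[lam01]_p%:E [EFin \o restrictions f k] `^ p = cube_int mu p f (e k).
Proof.
move=> mf; rewrite Lnorm_EFin_pow// /cube_int.
by rewrite (integral_cube_param mu_def (e k) (measurable_pow p mf) (pow_ge0 p f)).
Qed.

(** For [f] in G^p the cubes carry the whole integral, and the bijection [e] reindexes them by the
    reals. *)
Lemma lp_norm_restrictions f : inG mu p f ->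
  \esum_(k in [set: R]) 'N[lam01]_p%:E [EFin \o restrictions f k] `^ p =
  \int[mu]_y (`|f y| `^ p)%:E.
Proof.
move=> [/(Lfun_powP _ p0)[mf _] [-> _]].
rewrite -esum_Oset (reindex_esum [set: R] _ e); last first.
  by rewrite setTT_bijective; exists e'.
by apply: eq_esum => k _; rewrite restrictions_norm.
Qed.

Lemma inG_restrictions f : inG mu p f -> in_lp p (restrictions f).
Proof.
move=> fG; have [/(Lfun_powP _ p0)[mf foo] _] := fG; split; last first.
  by rewrite lp_norm_restrictions.
move=> k; apply/(Lfun_powP _ p0); split; first exact: measurable_restrictions.
rewrite -Lnorm_EFin_pow// restrictions_norm//; apply: le_lt_trans foo.
apply: ge0_subset_integral => //.
- exact: measurable_cube.
- exact: measurable_pow.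
Qed.

Lemma lp_norm_eq0 (F : R -> R -> R) :
  (forall k, \int[lam01]_x (`|F k x| `^ p)%:E = 0) -> lp_norm p F = 0.
Proof.
move=> F0; rewrite /lp_norm esum1; last by move=> k _; rewrite Lnorm_EFin_pow.
by rewrite poweR0r// invr_neq0// gt_eqF.
Qed.

Lemma restrictions_onto F : in_lp p F -> exists f, inG mu p f /\
  lp_norm p (fun k x => restrictions f k x - F k x)%R = 0.
Proof.
move=> [FL Foo].
have mFk k : measurable_fun setT (F k : RR -> R) by case/(Lfun_powP _ p0): (FL k).
have [r [mr rK]] := @param_inverse R.
pose c k := \int[lam01]_x (`|F k x| `^ p)%:E.
have {}Foo : \esum_(k in [set: R]) c k < +oo.
  by apply: le_lt_trans Foo; apply: le_esum => k _; rewrite Lnorm_EFin_pow.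
have c0 k : 0 <= c k by apply: integral_ge0 => x _; exact: pow_ge0.
(* Components of norm zero are discarded, leaving countably many cubes; this makes the glued
   function measurable and changes the family only by a null element. *)
pose D := [set a | c (e' a) != 0].
have cD : countable D.
  have := esum_countable_support c0 Foo; apply: sub_countable.
  rewrite (_ : D = e @` [set k | c k != 0]); first exact: card_image_le.
  apply/seteqP; split => [a Da|_ [k ck <-]]; first by exists (e' a).
  by rewrite /D/= eK.
pose floors (y : @Binf R) n := Num.floor (y n).
have floorsE a y : cube a y -> floors y = a.
  by move=> ay; apply/funext => n; apply: floor_def; case: (ay n) => -> ->.
(* The floors of the coordinates identify the cube containing [y]; the corresponding component is
   transplanted there through the inverse parametrisation. *)
pose f y : R := if floors y \in D then F (e' (floors y)) (r (floors y) y) else 0%R.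
have fE a y : D a -> cube a y -> f y = F (e' a) (r a y).
  by move=> Da ay; rewrite /f (floorsE a)// mem_set.
have f0 y : ~ (\bigcup_(a in D) cube a) y -> f y = 0%R.
  move=> nDy; rewrite /f; case: ifPn => // /set_mem Dy; exfalso; apply: nDy.
  by exists (floors y) => // n; have /andP := floor_itv (y n).
have mD : measurable (\bigcup_(a in D) cube a : set (@Binf R)) by exact: measurable_cubes.
have mf : measurable_fun setT f.
  rewrite -(setUv (\bigcup_(a in D) cube a)).
  apply/measurable_funU => //; first exact: measurableC.
  split.
    apply: measurable_fun_cubes => // a Da.
    apply: (@eq_measurable_fun _ _ _ _ _ (F (e' a) \o r a)).
      by move=> y /set_mem ay; rewrite (fE a).
    by apply: measurable_funTS; exact: (measurableT_comp (mFk _) (mr a)).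
  apply: (@eq_measurable_fun _ _ _ _ _ (cst (0%R : R))); last exact: measurable_cst.
  by move=> y /set_mem nDy; rewrite f0.
have fparam k x : good x -> restrictions f k x = if c k != 0 then F k x else 0%R.
  move=> gx; have ax := param_cube (e k) gx; rewrite /restrictions.
  case: ifPn => ck; first by rewrite (fE (e k))// ?rK ?eK// /D/= eK.
  apply: f0 => -[b Db bx]; move: ck Db.
  by rewrite /D/= -(cube_inj ax bx) eK => /negbTE ->.
have cubeE k : cube_int mu p f (e k) = c k.
  rewrite -restrictions_norm// Lnorm_EFin_pow//.
  transitivity (\int[lam01]_x (`|if c k != 0 then F k x else 0%R| `^ p)%:E).
    apply: integral_lam01_good.
    - by apply: measurable_pow; exact: measurable_restrictions.
    - by apply: measurable_pow; case: (c k != 0) => //=; exact: mFk.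
    - by move=> x; exact: pow_ge0.
    - by move=> x; rewrite lee_fin powR_ge0.
    - by move=> x gx; rewrite fparam.
  case: (boolP (c k != 0)) => [//|/negbNE/eqP ->].
  by apply: integral0_eq => x _; rewrite normr0 powR0// gt_eqF.
exists f; split.
  apply: (@inG_supported _ _ _ p0 _ D) => //.
  apply: le_lt_trans Foo.
  rewrite esum_mkcond (reindex_esum [set: R] _ e); last first.
    by rewrite setTT_bijective; exists e'.
  by apply: le_esum => k _; case: ifPn => _; rewrite ?cubeE.
apply: lp_norm_eq0 => k.
(* At good points the difference is 0 for a retained component and minus [F k] for a discarded one,
   whose integral [c k] is 0. *)
transitivity (\int[lam01]_x (`|if c k != 0 then 0%R else F k x| `^ p)%:E).
  apply: integral_lam01_good.
  - apply: measurable_pow; apply: measurable_funB; last exact: mFk.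
    exact: measurable_restrictions.
  - by apply: measurable_pow; case: (c k != 0) => //=; exact: mFk.
  - by move=> x; rewrite lee_fin powR_ge0.
  - by move=> x; rewrite lee_fin powR_ge0.
  - move=> x gx; rewrite fparam//; case: ifPn => _; rewrite ?subrr//.
    by rewrite sub0r normrN.
case: (boolP (c k != 0)) => [_|/negbNE/eqP //].
by apply: integral0_eq => x _; rewrite normr0 powR0// gt_eqF.
Qed.

End Isomorphism.

(** * Assembly of the decomposition, with all norm constants equal to 1 *)

Theorem theorem3p7 (R : realType) (mu : {measure set (@Binf R) -> \bar R})
  (mu_def : forall A : set (@Binf R), measurable A -> mu A = mu_star A)
  (p : R) (p1 : 1 <= p) :
  [/\ (* L^p = G^p + B^p with a bounded projection onto G^p along B^p *)
      (exists C : R, 0 < C /\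
        forall f : Binf -> R, f \in Lfun mu p%:E ->
          exists g b : Binf -> R,
            [/\ inG mu p g, inB mu p b, f = (fun x => g x + b x)
              & (Lpnorm mu p g <= C%:E * Lpnorm mu p f)%E]),
      (* G^p and B^p intersect trivially in L^p *)
      (forall g : Binf -> R, inG mu p g -> inB mu p g -> Lpnorm mu p g = 0%E)
    & (* G^p is isomorphic (as a Banach space) to l^p(c, L^p[0,1]) *)
      (exists (T : (Binf -> R) -> R -> R -> R) (c1 c2 : R),
        [/\ 0 < c1 /\ 0 < c2,
            (forall f, inG mu p f -> in_lp p (T f)),
            (forall (a : R) f g, inG mu p f -> inG mu p g ->
              lp_norm p (fun k x => T (fun y => a * f y + g y) k x
                                    - (a * T f k x + T g k x)) = 0%E),
            (forall f, inG mu p f ->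
              (c1%:E * Lpnorm mu p f <= lp_norm p (T f)
               <= c2%:E * Lpnorm mu p f)%E)
          & (forall F, in_lp p F ->
              exists f, inG mu p f /\
                lp_norm p (fun k x => T f k x - F k x) = 0%E)])].
Proof.
have p0 : 0 < p by exact: lt_le_trans p1.
have [e [e' eK e'K]] := @int_seq_continuum R.
split.
(* Truncation to [Fset] does not increase the norm, so the projection has constant 1. *)
- exists 1; split => // f /(Lfun_decomp p0)[g [b [gG bB fE gf]]].
  by exists g, b; split => //; rewrite mul1e.
- by move=> g; exact: inG_inB_norm0.
(* Composition with the parametrisations is an isometry and is linear pointwise, so the linearity
   defect is the zero function. *)
exists (restrictions e), 1, 1; split => //.
- by move=> f; exact: (inG_restrictions mu_def p0 eK e'K).
- move=> a f g _ _; apply: lp_norm_eq0 => // k.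
  by apply: integral0_eq => x _; rewrite /restrictions subrr normr0 powR0// gt_eqF.
- move=> f fG; rewrite !mul1e /lp_norm (lp_norm_restrictions mu_def p0 eK e'K fG).
  by rewrite /Lpnorm Lnorm_EFin lexx.
- by move=> F; exact: restrictions_onto.
Qed.
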